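(* Let $L$ be a finite-dimensional solvable Lie algebra over a field $F$. Then every $3$-maximal subalgebra of $L$ is an ideal of $L$ if and only if one of the following holds: (i) $L$ is nilpotent and $\phi(K)=\phi(M)$ for every $2$-maximal subalgebra $K$ of $L$ and every maximal subalgebra $M$ of $L$ containing $K$; or (ii) $\dim L\leq 3$.
   Context: For a positive integer $n$, an $n$-maximal subalgebra of $L$ is a subalgebra $S_0$ for which there is a chain $S_0<S_1<\cdots<S_n=L$ of subalgebras with each $S_i$ a maximal subalgebra of $S_{i+1}$. For a Lie algebra $K$, $\phi(K)$ is the Frattini ideal of $K$: the largest ideal of $K$ contained in the intersection of all maximal subalgebras of $K$. *)

(* Defs.v *)
(* MathComp, plus mathcomp.classical for the choice of the Frattini ideal. *)
From HB Require Import structures.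
From mathcomp Require Import all_boot all_order all_algebra.
From mathcomp Require Import boolp classical_sets.
Set Implicit Arguments. Unset Strict Implicit. Unset Printing Implicit Defensive.
Import GRing.Theory.
Local Open Scope ring_scope.

HB.mixin Record Vector_isLie (F : fieldType) L of Vector F L := {
  bracket : L -> L -> L;
  bracket_linl : forall (a : F) (x y z : L),
    bracket (a *: x + y) z = a *: bracket x z + bracket y z;
  bracket_linr : forall (a : F) (x y z : L),
    bracket x (a *: y + z) = a *: bracket x y + bracket x z;
  bracketxx : forall x : L, bracket x x = 0;
  bracket_jacobi : forall x y z : L,
    bracket x (bracket y z) + bracket y (bracket z x)
      + bracket z (bracket x y) = 0
}.

(* Finite-dimensionality comes from the inherited [vectType F]. *)
#[short(type="lieAlgType")]
HB.structure Definition LieAlg (F : fieldType) :=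
  { L of Vector F L & Vector_isLie F L }.

Section LieTheory.
Variables (F : fieldType) (L : lieAlgType F).
Implicit Types (x y z : L) (U V W S T I J K M : {vspace L}) (n : nat).

Definition lie_subalg S : Prop := {in S &, forall x y, bracket x y \in S}.

(* I is an ideal of K; two-sidedness is automatic by anticommutativity. *)
Definition lie_ideal I K : Prop :=
  (I <= K)%VS /\ {in K & I, forall x y, bracket x y \in I}.

(* S is a maximal subalgebra of T. *)
Definition maximal_subalg S T : Prop :=
  [/\ lie_subalg S, lie_subalg T, (S <= T)%VS, S != T &
      forall U, lie_subalg U -> (S <= U)%VS -> (U <= T)%VS -> U = S \/ U = T].

(* S0 is an n-maximal subalgebra of the whole algebra L. *)
Definition nmaximal_subalg n S0 : Prop :=
  exists S : nat -> {vspace L},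
    [/\ S 0%N = S0, S n = {:L}%VS &
        forall i, (i < n)%N -> maximal_subalg (S i) (S i.+1)].

(* [U, V]: the span of all the brackets, see [lie_prodP]. *)
Definition lie_prod U V : {vspace L} :=
  <<[seq bracket u v | u <- vbasis U, v <- vbasis V]>>%VS.

Definition derived_series K n : {vspace L} :=
  iter n (fun U => lie_prod U U) K.

Definition lower_central_series K n : {vspace L} :=
  iter n (fun U => lie_prod K U) K.

Definition lie_solvable K : Prop := exists n, derived_series K n = 0%VS.

Definition lie_nilpotent K : Prop := exists n, lower_central_series K n = 0%VS.

(* An ideal of K inside the intersection of all maximal subalgebras of K; when
   K has no maximal subalgebra that intersection is K itself. *)
Definition ideal_in_maximals K I : Prop :=
  lie_ideal I K /\ forall M, maximal_subalg M K -> (I <= M)%VS.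

Definition is_frattini K I : Prop :=
  ideal_in_maximals K I /\ forall J, ideal_in_maximals K J -> (J <= I)%VS.

(* The default value 0 is never used, by [frattiniP]. *)
Definition frattini K : {vspace L} := xget 0%VS [set I | is_frattini K I]%classic.

Lemma bracketDl x y z : bracket (x + y) z = bracket x z + bracket y z.
Proof. by have := bracket_linl 1 x y z; rewrite !scale1r. Qed.

Lemma bracketDr x y z : bracket x (y + z) = bracket x y + bracket x z.
Proof. by have := bracket_linr 1 x y z; rewrite !scale1r. Qed.

Lemma bracket0l z : bracket 0 z = 0 :> L.
Proof. by apply: (addrI (bracket 0 z)); rewrite -bracketDl !addr0. Qed.

Lemma bracket0r z : bracket z 0 = 0 :> L.
Proof. by apply: (addrI (bracket z 0)); rewrite -bracketDr !addr0. Qed.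

Lemma bracketZl a x z : bracket (a *: x) z = a *: bracket x z.
Proof. by rewrite -[a *: x]addr0 bracket_linl bracket0l addr0. Qed.

Lemma bracketZr a x z : bracket x (a *: z) = a *: bracket x z.
Proof. by rewrite -[a *: z]addr0 bracket_linr bracket0r addr0. Qed.

Lemma bracket_suml m (f : 'I_m -> L) z :
  bracket (\sum_i f i) z = \sum_i bracket (f i) z.
Proof.
exact: (big_morph (fun x => bracket x z) (fun x y => bracketDl x y z)
  (bracket0l z)).
Qed.

Lemma bracket_sumr m (f : 'I_m -> L) z :
  bracket z (\sum_i f i) = \sum_i bracket z (f i).
Proof. exact: (big_morph (bracket z) (bracketDr z) (bracket0r z)). Qed.

Lemma memv_lie_prod U V : {in U & V, forall u v, bracket u v \in lie_prod U V}.
Proof.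
move=> u v /coord_vbasis-> /coord_vbasis->.
rewrite bracket_suml; apply: memv_suml => i _.
rewrite bracket_sumr; apply: memv_suml => j _.
rewrite bracketZl bracketZr !memvZ // memv_span //.
by apply/allpairsP; exists ((vbasis U)`_i, (vbasis V)`_j); rewrite !memt_nth.
Qed.

Lemma lie_prodP U V W :
  reflect {in U & V, forall u v, bracket u v \in W} (lie_prod U V <= W)%VS.
Proof.
apply: (iffP idP) => [sUVW u v Uu Vv | sUVW].
  by rewrite (subvP sUVW) ?memv_lie_prod.
apply/span_subvP=> _ /allpairsP[[u v] /= [Uu Vv ->]].
by rewrite sUVW ?vbasis_mem.
Qed.

Lemma ideal_in_maximals0 K : ideal_in_maximals K 0%VS.
Proof.
split=> [|M _]; last exact: sub0v.
split=> [|x y _]; first exact: sub0v.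
by rewrite memv0 => /eqP ->; rewrite bracket0r mem0v.
Qed.

Lemma ideal_in_maximalsD K I J :
  ideal_in_maximals K I -> ideal_in_maximals K J ->
  ideal_in_maximals K (I + J)%VS.
Proof.
move=> [[IK idI] maxI] [[JK idJ] maxJ]; split.
  split=> [|x _ Kx /memv_addP[u Iu [v Jv ->]]]; first by rewrite subv_add IK JK.
  by rewrite bracketDr memv_add ?idI ?idJ.
by move=> M maxM; rewrite subv_add maxI ?maxJ.
Qed.

Lemma is_frattini_ex K : exists I, is_frattini K I.
Proof.
pose P d := `[< exists2 I, ideal_in_maximals K I & \dim I = d >].
have exP : exists d, P d.
  by exists 0%N; apply/asboolP; exists 0%VS; rewrite ?dimv0 //;
     exact: ideal_in_maximals0.
have ubP d : P d -> (d <= \dim {:L})%N.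
  by move=> /asboolP[I _ <-]; exact/dimvS/subvf.
case: (ex_maxnP exP ubP) => d /asboolP[I PI dI] maxd.
exists I; split=> // J PJ.
have sI : (I <= I + J)%VS by exact: addvSl.
have /eqP-> : I == (I + J)%VS; last exact: addvSr.
rewrite eqEdim sI dI maxd //.
by apply/asboolP; exists (I + J)%VS => //; exact: ideal_in_maximalsD.
Qed.

Lemma frattiniP K : is_frattini K (frattini K).
Proof. exact: (xgetPex _ (is_frattini_ex K)). Qed.

Lemma frattini_unique K I : is_frattini K I -> I = frattini K.
Proof.
case: (frattiniP K) => PK maxK [PI maxI].
by apply: subv_anti; rewrite maxK ?maxI.
Qed.

End LieTheory.

(* Main.v *)
From HB Require Import structures.
Require Import Defs.
From mathcomp Require Import all_boot all_order all_algebra.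
From mathcomp Require Import boolp.

(* Write K' = [K, K].  When dim L > 3 and all 3-maximal subalgebras are ideals,
   let K be 2-maximal with dim K > 1.  Its maximal subalgebras are ideals of L,
   so they contain K', and every proper subspace of K above K' is an
   intersection of ideals of L; moreover T + K' = K forces T = K for subalgebras
   T, whence K' + <v> != K for all v in K, and [L, v] lies in K' + <v>.
   For codimension-one steps K < M < L with M' <= K and L' <= M this yields
   K' = M' = L'.  Thus T + L' = L forces T = L, so that the Fitting null component
   of every ad x is L, and L is nilpotent by Engel's theorem.
   In a nilpotent algebra the Frattini ideal is the derived algebra, so both
   directions are statements about derived algebras of subalgebras of
   codimension one and two. *)

Set Implicit Arguments. Unset Strict Implicit. Unset Printing Implicit Defensive.

(** * Subspaces of codimension one *)

Section Hyperplanes.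
Import GRing.Theory.
Local Open Scope ring_scope.
Variables (F : fieldType) (V : vectType F).
Implicit Types (v w x : V) (H K U W : {vspace V}).

Lemma exists_maxdim (P : {vspace V} -> Prop) U :
  P U -> exists2 W, P W & forall W', P W' -> (\dim W' <= \dim W)%N.
Proof.
move=> PU; pose Q d := `[< exists2 W, P W & \dim W = d >].
have exQ : exists d, Q d by exists (\dim U); apply/asboolP; exists U.
have ubQ d : Q d -> (d <= \dim {:V})%N.
  by move=> /asboolP[W _ <-]; exact/dimvS/subvf.
case: (ex_maxnP exQ ubQ) => d /asboolP[W PW dW] maxd.
by exists W => // W' PW'; rewrite dW maxd //; apply/asboolP; exists W'.
Qed.

Definition hyperplane H K : Prop := (H <= K)%VS /\ \dim K = (\dim H).+1.

Lemma memv_addlineP U v w :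
  reflect (exists2 u, u \in U & exists a, w = u + a *: v) (w \in U + <[v]>)%VS.
Proof.
apply: (iffP memv_addP) => [[u Uu [_ /vlineP[a ->] ->]]|[u Uu [a ->]]].
  by exists u => //; exists a.
by exists u => //; exists (a *: v) => //; rewrite memvZ ?memv_line.
Qed.

Lemma addline_hyperplane H v : v \notin H -> hyperplane H (H + <[v]>)%VS.
Proof.
move=> Hv; split; first exact: addvSl.
rewrite dimv_disjoint_sum.
  rewrite dim_vline (_ : v != 0) ?addn1 //.
  by apply: contraNneq Hv => ->; exact: mem0v.
apply/eqP; rewrite -subv0; apply/subvP => w /memv_capP[Hw /vlineP[a wE]].
rewrite memv0 wE; have [->|a0] := eqVneq a 0; first by rewrite scale0r.
by case/negP: Hv; rewrite -[v](scalerK a0) -wE memvZ.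
Qed.

Lemma hyperplane_neq H K : hyperplane H K -> H != K.
Proof. by case=> _ dK; apply/eqP => HK; move: dK; rewrite HK => /n_Sn. Qed.

Lemma hyperplane_addline H K v :
  hyperplane H K -> v \in K -> v \notin H -> K = (H + <[v]>)%VS.
Proof.
move=> [HK dK] Kv Hv; apply/esym/eqP; rewrite eqEdim subv_add HK -memvE Kv /=.
by rewrite dK; case: (addline_hyperplane Hv) => _ ->.
Qed.

Lemma hyperplane_between H K U :
  hyperplane H K -> (H <= U)%VS -> (U <= K)%VS -> U = H \/ U = K.
Proof.
move=> hHK HU UK; have [UH|/subvPn[u Uu Hu]] := boolP (U <= H)%VS.
  by left; apply: subv_anti; rewrite UH.
right; apply: subv_anti; rewrite UK (hyperplane_addline hHK _ Hu) ?(subvP UK) //.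
by rewrite subv_add HU -memvE.
Qed.

Lemma hyperplane_outside H K : hyperplane H K -> exists2 v, v \in K & v \notin H.
Proof.
move=> [HK dK]; apply/subvPn; apply/negP => /dimvS.
by rewrite dK ltnn.
Qed.

(** A complement of U + <v> in K, added to U, serves as H. *)
Lemma hyperplane_avoiding U K v : (U <= K)%VS -> v \in K -> v \notin U ->
  exists H, [/\ (U <= H)%VS, hyperplane H K & v \notin H].
Proof.
move=> UK Kv Uv; pose D := (K :\: (U + <[v]>))%VS; exists (U + D)%VS.
have Hv : v \notin (U + D)%VS.
  apply/negP => /memv_addP[u Uu [d Dd vE]].
  have d0 : d = 0.
    apply/eqP; rewrite -memv0 -(capv_diff K (U + <[v]>)%VS) memv_cap Dd /=.
    apply/memv_addlineP; exists (- u); rewrite ?memvN //; exists 1.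
    by rewrite vE scale1r addrA addNr add0r.
  by case/negP: Uv; rewrite vE d0 addr0.
split; [exact: addvSl| |by []].
suff KE : (U + D + <[v]>)%VS = K by rewrite -KE; exact: addline_hyperplane.
rewrite -addvA [(D + _)%VS]addvC addvA addvC addv_diff.
by apply/addv_idPl; rewrite subv_add UK -memvE.
Qed.

Lemma hyperplane_containing U K : (U <= K)%VS -> U != K ->
  exists2 H, (U <= H)%VS & hyperplane H K.
Proof.
rewrite eqEsubv => UK; rewrite UK /= => /subvPn[v Kv Uv].
by have [H [UH hHK _]] := hyperplane_avoiding UK Kv Uv; exists H.
Qed.

Lemma hyperplane_addline2 H K x :
  hyperplane H K -> x \notin K -> hyperplane (H + <[x]>)%VS (K + <[x]>)%VS.
Proof.
move=> [HK dK] Kx; split; first by rewrite addvS.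
have Hx : x \notin H by apply: contra Kx; exact/subvP.
by rewrite (addline_hyperplane Kx).2 (addline_hyperplane Hx).2 dK.
Qed.

(** A nonzero coefficient at x would put x in K; this is a case of the modular law. *)
Lemma memv_addlineI H K x w :
  (H <= K)%VS -> x \notin K -> w \in (H + <[x]>)%VS -> w \in K -> w \in H.
Proof.
move=> HK Kx /memv_addlineP[h Hh [a ->]] Kw.
have [->|a0] := eqVneq a 0; first by rewrite scale0r addr0.
case/negP: Kx; rewrite -[x](scalerK a0) memvZ //.
by rewrite -[_ *: x](addKr h) memvD // memvN (subvP HK).
Qed.

Lemma dim_addline_leq U v : (\dim (U + <[v]>) <= (\dim U).+1)%N.
Proof.
apply: leq_trans (dimv_add_leqif _ _) _; rewrite dim_vline.
by rewrite -addn1 leq_add2l leq_b1.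
Qed.

(** Exchange argument: as w is outside U, its coefficient at v is nonzero. *)
Lemma memv_addline_swap U H v w : w \in (U + <[v]>)%VS -> w \notin U ->
  (U <= H)%VS -> w \in H -> v \in H.
Proof.
move=> /memv_addlineP[u Uu [a ->]] Uw /subvP UH Hw.
have [a0|a0] := eqVneq a 0.
  by case/negP: Uw; rewrite a0 scale0r addr0.
rewrite -[v](scalerK a0) memvZ //.
by rewrite -[_ *: v](addKr u) memvD // memvN UH.
Qed.

End Hyperplanes.

(** * Brackets, derived algebras and maximal subalgebras *)

Section Lie.
Import GRing.Theory.
Local Open Scope ring_scope.
Variables (F : fieldType) (L : lieAlgType F).
Implicit Types (u v w x y z : L) (H I K M N S T U W : {vspace L}).

Local Notation der U := (lie_prod U U).
Local Notation L' := (der (fullv : {vspace L})).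

Lemma bracketN x y : bracket x y = - bracket y x.
Proof.
apply/eqP; rewrite -addr_eq0; apply/eqP.
have := bracketxx (x + y).
by rewrite bracketDl !bracketDr !bracketxx add0r addr0.
Qed.

Lemma bracket_memC U x y : (bracket x y \in U) = (bracket y x \in U).
Proof. by rewrite bracketN memvN. Qed.

(** The Jacobi identity read as the Leibniz rule for ad x. *)
Lemma bracket_ad x y z :
  bracket x (bracket y z) = bracket (bracket x y) z + bracket y (bracket x z).
Proof.
have := bracket_jacobi x y z; rewrite (bracketN z (bracket x y)) (bracketN z x).
rewrite -[- bracket x z]scaleN1r bracketZr scaleN1r => /eqP.
by rewrite -addrA -opprD subr_eq0 addrC => /eqP.
Qed.

Lemma lie_prodS U1 U2 W1 W2 :
  (U1 <= U2 -> W1 <= W2 -> lie_prod U1 W1 <= lie_prod U2 W2)%VS.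
Proof.
move=> /subvP sU /subvP sW; apply/lie_prodP => u w /sU Uu /sW Ww.
exact: memv_lie_prod.
Qed.

Lemma lie_subalgE S : lie_subalg S <-> (der S <= S)%VS.
Proof. by split=> [sS|/lie_prodP//]; apply/lie_prodP. Qed.

Lemma lie_subalgf : lie_subalg {:L}.
Proof. by move=> x y _ _; exact: memvf. Qed.

Lemma der_subalg K U : (der K <= U)%VS -> (U <= K)%VS -> lie_subalg U.
Proof.
by move=> dU UK; apply/lie_subalgE; apply: subv_trans dU; exact: lie_prodS.
Qed.

(** Since [y, y] = 0, only [S, S] and [y, S] contribute. *)
Lemma addline_der_sub S y W : (der S <= W)%VS ->
  {in S, forall s, bracket y s \in W} -> (der (S + <[y]>) <= W)%VS.
Proof.
move=> /lie_prodP dS yS; apply/lie_prodP.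
move=> _ _ /memv_addlineP[s Ss [a ->]] /memv_addlineP[t St [b ->]].
rewrite !(bracketDl, bracketDr) !(bracketZl, bracketZr) bracketxx !scaler0 addr0.
rewrite memvD ?memvZ ?yS // memvD ?dS // memvZ //.
by rewrite bracket_memC yS.
Qed.

Lemma addline_subalg S y : lie_subalg S ->
  {in S, forall s, bracket y s \in (S + <[y]>)%VS} -> lie_subalg (S + <[y]>).
Proof.
move=> /lie_subalgE sS yS; apply/lie_subalgE; apply: addline_der_sub => //.
exact: subv_trans sS (addvSl _ _).
Qed.

Lemma hyperplane_maximal H K :
  lie_subalg H -> lie_subalg K -> hyperplane H K -> maximal_subalg H K.
Proof.
move=> sH sK hHK; split=> //; [by case: hHK|exact: hyperplane_neq|].
by move=> U _; exact: hyperplane_between.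
Qed.

Lemma der_hyperplane_maximal H K : lie_subalg K ->
  (der K <= H)%VS -> hyperplane H K -> maximal_subalg H K.
Proof.
by move=> sK dH hHK; apply: hyperplane_maximal => //; apply: der_subalg dH hHK.1.
Qed.

(** As y normalises S, the subspace S + <y> is a subalgebra, so it is K by maximality. *)
Lemma maximal_normalized S K y : maximal_subalg S K -> y \in K -> y \notin S ->
  {in S, forall s, bracket y s \in S} -> (der K <= S)%VS /\ hyperplane S K.
Proof.
move=> [sS sK SK _ maxS] Ky Sy yS.
have hS := addline_hyperplane Sy.
have KE : (S + <[y]>)%VS = K.
  have [||||//] := maxS (S + <[y]>)%VS.
  - by apply: addline_subalg => // s /yS; exact/subvP/addvSl.
  - exact: addvSl.
  - by rewrite subv_add SK -memvE.
  - by move/eqP; rewrite eq_sym (negPf (hyperplane_neq hS)).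
by rewrite -KE; split=> //; apply: addline_der_sub => //; apply/lie_subalgE.
Qed.

Lemma maximal_ideal S K : maximal_subalg S K -> lie_ideal S K ->
  (der K <= S)%VS /\ hyperplane S K.
Proof.
move=> mS [_ idS]; have [_ _ SK nSK _] := mS.
have /subvPn[y Ky Sy] : ~~ (K <= S)%VS.
  by apply: contra nSK => KS; rewrite eqEsubv SK.
by apply: (maximal_normalized mS Ky Sy) => s; exact: idS.
Qed.

Lemma maximal_containing T K : lie_subalg T -> lie_subalg K ->
  (T <= K)%VS -> T != K -> exists2 S, (T <= S)%VS & maximal_subalg S K.
Proof.
move=> sT sK TK nTK.
pose P U := [/\ lie_subalg U, (T <= U)%VS, (U <= K)%VS & U != K].
have PT : P T by split.
have [S [sS TS SK nSK] maxS] := exists_maxdim PT.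
exists S => //; split=> // U sU SU UK.
have [->|nUK] := eqVneq U K; [by right|left].
apply/esym/eqP; rewrite eqEdim SU; apply: maxS; split=> //.
exact: subv_trans SU.
Qed.

Lemma nmaximal_subalgS n S T : maximal_subalg S T ->
  nmaximal_subalg n T -> nmaximal_subalg n.+1 S.
Proof.
move=> mS [f [f0 fn mf]]; exists (fun i => if i is j.+1 then f j else S).
by split=> // -[|i] /=; [rewrite f0|exact: mf].
Qed.

Lemma nmaximal_subalgSP n S : nmaximal_subalg n.+1 S ->
  exists2 T, maximal_subalg S T & nmaximal_subalg n T.
Proof.
move=> [f [f0 fn mf]]; exists (f 1%N); first by rewrite -f0; exact: mf.
by exists (fun i => f i.+1); split=> // i; exact: (mf i.+1).
Qed.

Lemma nmaximal_subalg1 M : maximal_subalg M fullv -> nmaximal_subalg 1 M.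
Proof.
move=> mM; apply: nmaximal_subalgS mM _.
by exists (fun=> fullv); split.
Qed.

Lemma nmaximal_subalg1P M : nmaximal_subalg 1 M -> maximal_subalg M fullv.
Proof. by case/nmaximal_subalgSP => T mM [f [f0 f1 _]]; rewrite -f1 f0. Qed.

(** Such a K lies in every term of the derived series of L. *)
Lemma sub_der_solvable K : lie_solvable (fullv : {vspace L}) ->
  (K <= der K)%VS -> K = 0%VS.
Proof.
move=> [n dn0] Kd; apply/eqP; rewrite -subv0 -dn0.
elim: n {dn0} => [|n IHn] /=; first exact: subvf.
by apply: subv_trans Kd _; exact: lie_prodS.
Qed.

(** * Powers of ad x and the Fitting null component *)

Fact bracket_linear x : linear (bracket x : L -> L).
Proof. by move=> a y z; exact: bracket_linr. Qed.
HB.instance Definition _ x :=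
  GRing.isLinear.Build F L L _ (bracket x) (bracket_linear x).

(** Built as an endomorphism so that [lker] and [limg] apply. *)
Definition ad_iter x n : 'End(L) := iter n (comp_lfun (linfun (bracket x))) \1%VF.

Lemma ad_iterS x n v : ad_iter x n.+1 v = bracket x (ad_iter x n v).
Proof. by rewrite /ad_iter /= comp_lfunE lfunE. Qed.

Lemma ad_iterE x n v : ad_iter x n v = iter n (bracket x) v.
Proof.
elim: n => [|n IHn]; first by rewrite /ad_iter /= lfunE.
by rewrite ad_iterS IHn.
Qed.

Lemma ad_iterD x m n v : ad_iter x (m + n) v = ad_iter x m (ad_iter x n v).
Proof. by rewrite !ad_iterE iterD. Qed.

Lemma ad_iterSr x n v : ad_iter x n.+1 v = ad_iter x n (bracket x v).
Proof. by rewrite !ad_iterE iterSr. Qed.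

(** By the Leibniz rule, one application of ad x leaves two brackets, in each of which m or n has
    dropped by one. *)
Lemma ad_iter_bracket x m n k a b : (m + n <= k)%N ->
  ad_iter x m a = 0 -> ad_iter x n b = 0 -> ad_iter x k (bracket a b) = 0.
Proof.
elim: k m n a b => [|k IHk] [|m] [|n] a b // le_mnk am bn;
  try by rewrite (_ : a = 0) ?bracket0l ?linear0 // -am ad_iterE.
  by rewrite (_ : b = 0) ?bracket0r ?linear0 // -bn ad_iterE.
rewrite ad_iterSr bracket_ad linearD /=.
rewrite (IHk m n.+1) ?(IHk m.+1 n) ?addr0 -?ad_iterSr //.
by rewrite addSnnS -ltnS -addSn.
Qed.

(* The null component of ad x in the Fitting decomposition is a subalgebra,
   and its complement, the image of a power of ad x, lies in L'. *)
Lemma ad_nilpotent :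
    (forall T, lie_subalg T -> (T + L')%VS = fullv -> T = fullv) ->
  forall x, exists n, forall v, ad_iter x n v = 0.
Proof.
(* Only positive exponents are allowed: the image of a positive power of ad x lies in L'. *)
move=> suppL x; pose P W := exists n, W = lker (ad_iter x n.+1).
have [|_ [n ->] maxW] := @exists_maxdim _ _ P (lker (ad_iter x 1)).
  by exists 0%N.
pose W := lker (ad_iter x n.+1); exists n.+1.
(* The kernels grow with the exponent, so they are constant from the one of largest dimension on. *)
have stab m v : ad_iter x (m + n.+1) v = 0 -> v \in W.
  move=> mv0; suff -> : W = lker (ad_iter x (m + n.+1)) by rewrite memv_ker mv0.
  apply/eqP; rewrite eqEdim maxW ?andbT; last by exists (m + n)%N; rewrite addnS.
  by apply/subvP => w; rewrite !memv_ker ad_iterD => /eqP ->; rewrite linear0.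
suff WL : W = fullv by move=> v; apply/eqP; rewrite -memv_ker -/W WL memvf.
apply: suppL => [a b Wa Wb|].
  apply: (stab n.+1); apply: ad_iter_bracket (leqnn _) _ _;
  by apply/eqP; rewrite -memv_ker.
apply/eqP; rewrite eqEsubv subvf /=.
apply: (@subv_trans _ _ (W + limg (ad_iter x n.+1))%VS); last first.
  apply: addvS => //; apply/subvP => _ /memv_imgP[u _ ->].
  by rewrite ad_iterS memv_lie_prod ?memvf.
have /eqP -> : (W + limg (ad_iter x n.+1))%VS == fullv; last exact: subvv.
rewrite eqEdim subvf dimv_disjoint_sum.
  by rewrite /= -{1}(limg_ker_dim (ad_iter x n.+1) fullv) capfv /W.
apply/eqP; rewrite -subv0; apply/subvP => w /memv_capP[].
rewrite memv_ker => /[swap] /memv_imgP[u _ ->].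
by rewrite -ad_iterD => /eqP /stab Wu; rewrite memv0 -memv_ker.
Qed.

(** * Engel's theorem for solvable algebras *)

Lemma lie_prod_stable y U W : {in U, forall u, bracket y u \in U} ->
    {in W, forall w, bracket y w \in W} ->
  {in lie_prod U W, forall p, bracket y p \in lie_prod U W}.
Proof.
(* The vectors that ad y sends into the product form a subspace, so brackets of generators
   suffice. *)
move=> yU yW p; rewrite -lfunE memv_preim; move: p.
apply/subvP/lie_prodP => u w Uu Ww; rewrite -memv_preim lfunE /= bracket_ad.
by rewrite memvD // memv_lie_prod ?yU ?yW.
Qed.

Lemma lower_central_series_stable H y n :
    {in H, forall h, bracket y h \in H} ->
  {in lower_central_series H n, forall u,
    bracket y u \in lower_central_series H n}.
Proof. by move=> yH; elim: n => //= n; exact: lie_prod_stable. Qed.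

Lemma lower_central_seriesS H n : lie_subalg H ->
  (lower_central_series H n.+1 <= lower_central_series H n)%VS.
Proof.
by move=> /lie_subalgE sH; elim: n => //= n IHn; exact: lie_prodS.
Qed.

(** Let A and C be the lower central series of H and of H + <y>. If C_k <= A_i, then C_(j+k) <=
    A_(i+1) + (ad y)^j A_i for all j; at j = m the last term vanishes, so C descends through the
    whole series A. *)
Lemma nilpotent_addline H y m : lie_subalg H ->
    {in H, forall h, bracket y h \in H} -> (forall v, ad_iter y m v = 0) ->
  lie_nilpotent H -> lie_nilpotent (H + <[y]>)%VS.
Proof.
move=> sH yH ym0 [n An0]; pose A := lower_central_series H.
pose N := (H + <[y]>)%VS; pose C := lower_central_series N.
have step i k : (C k <= A i)%VS ->
    forall j, (C (j + k)%N <= A i.+1 + (ad_iter y j @: A i))%VS.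
  move=> Ck; elim=> [|j IHj].
    rewrite add0n; apply: subv_trans (addvSr _ _); apply: subv_trans Ck _.
    by apply/subvP => v Av; rewrite -[v](ad_iterE y 0 v) memv_img.
  apply/lie_prodP => _ u /memv_addlineP[h Hh [a ->]] /(subvP IHj).
  move=> /memv_addP[c Ac [_ /memv_imgP[d Ad ->] ->]].
  rewrite bracketDl bracketZl [bracket y _]bracketDr scalerDr addrA.
  apply: memv_add; last by rewrite -ad_iterS -linearZ memv_img ?memvZ.
  have Af : ad_iter y j d \in A i.
    elim: j {IHj} => [|j IHj]; first by rewrite ad_iterE.
    by rewrite ad_iterS (lower_central_series_stable yH).
  have Ai_c : c \in A i by apply: (subvP (lower_central_seriesS _ sH)).
  apply: memvD; first exact: memv_lie_prod Hh (memvD Ai_c Af).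
  exact/memvZ/(lower_central_series_stable yH).
have [k Ck] : exists k, (C k <= A n)%VS.
  elim: n {An0} => [|i [k Ck]].
    exists 1%N; apply: addline_der_sub => //; exact/lie_subalgE.
  exists (m + k)%N; apply: subv_trans (step _ _ Ck m) _.
  rewrite subv_add subvv; apply/subvP => _ /memv_imgP[u _ ->].
  by rewrite ym0 mem0v.
by exists k; apply/eqP; rewrite -subv0 -An0.
Qed.

Lemma der_containing K : lie_solvable (fullv : {vspace L}) -> lie_subalg K ->
  K != 0%VS -> exists2 H, (der K <= H)%VS & hyperplane H K.
Proof.
move=> solL sK nK0; apply: hyperplane_containing; first exact/lie_subalgE.
by apply: contraNneq nK0 => dKK; apply/eqP/sub_der_solvable; rewrite // dKK.
Qed.

(** Induction on dim N: a hyperplane H of N above N' is normalised by any y of N outside it and is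
    nilpotent by induction, so [nilpotent_addline] applies to N = H + <y>. *)
Lemma engel_solvable : lie_solvable (fullv : {vspace L}) ->
    (forall x, exists n, forall v, ad_iter x n v = 0) ->
  lie_nilpotent (fullv : {vspace L}).
Proof.
move=> solL nilad.
suff nil_subalg N : lie_subalg N -> lie_nilpotent N.
  by apply: nil_subalg; exact: lie_subalgf.
have [d] := ubnP (\dim N); elim: d N => // d IHd N.
rewrite ltnS => dN sN; have [N0|nN0] := eqVneq N 0%VS; first by exists 0%N.
have [H dH hHN] := der_containing solL sN nN0.
have [y Ny Hy] := hyperplane_outside hHN.
have [m ym0] := nilad y; have sH := der_subalg dH hHN.1.
rewrite (hyperplane_addline hHN Ny Hy); apply: (@nilpotent_addline _ _ m) => //.
  move=> h Hh; apply: (subvP dH); rewrite memv_lie_prod //.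
  exact: (subvP hHN.1).
by apply: IHd => //; rewrite -ltnS -hHN.2.
Qed.

(** * Maximal subalgebras and Frattini ideals in nilpotent algebras *)

(** Let C_(m+1) be the first term of the lower central series of L that meets T inside S. An element
    y of C_m and T outside S satisfies [y, S] <= S, so it normalises S. *)
Lemma nilpotent_maximal S T : lie_nilpotent (fullv : {vspace L}) ->
  maximal_subalg S T -> (der T <= S)%VS /\ hyperplane S T.
Proof.
move=> [n Cn0] mS; have [_ sT ST nST _] := mS.
pose C := lower_central_series (fullv : {vspace L}).
have exQ : exists n, (C n :&: T <= S)%VS.
  by exists n; rewrite /C Cn0 cap0v sub0v.
case: (ex_minnP exQ) => -[|m] Cm minm.
  by case/negP: nST; rewrite eqEsubv ST; move: Cm; rewrite /C /= capfv.
have /subvPn[y /memv_capP[Cy Ty] Sy] : ~~ (C m :&: T <= S)%VS.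
  by apply/negP => /minm; rewrite ltnn.
apply: (maximal_normalized mS Ty Sy) => s Ss; apply: (subvP Cm).
have Ts := subvP ST s Ss.
by rewrite memv_cap sT // andbT bracket_memC memv_lie_prod ?memvf.
Qed.

(** K' is the intersection of the hyperplanes of K above it, all of which are maximal subalgebras;
    conversely every maximal subalgebra contains K'. *)
Lemma frattini_nilpotent K : lie_nilpotent (fullv : {vspace L}) ->
  lie_subalg K -> frattini K = der K.
Proof.
move=> nilL sK; have dK : (der K <= K)%VS by exact/lie_subalgE.
apply/esym/frattini_unique; split.
  split=> [|M mM]; last by case: (nilpotent_maximal nilL mM).
  by split=> // x y Kx /(subvP dK) Ky; exact: memv_lie_prod.
move=> J [[JK _] maxJ]; apply/subvP => v Jv; apply/negPn/negP => dv.
have [H [dH hHK Hv]] := hyperplane_avoiding dK (subvP JK v Jv) dv.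
case/negP: Hv; apply: (subvP (maxJ H _) v Jv).
exact: der_hyperplane_maximal.
Qed.

(** * Algebras whose 3-maximal subalgebras are all ideals *)

Section MaximalIdeals.
Hypothesis solL : lie_solvable (fullv : {vspace L}).
Hypothesis ideal3 : forall S, nmaximal_subalg 3 S -> lie_ideal S fullv.

Lemma max2_subalg K : nmaximal_subalg 2 K -> lie_subalg K.
Proof. by case/nmaximal_subalgSP => M []. Qed.

(** A proper T would lie in a maximal subalgebra of K; being an ideal of L, that contains K', hence
    T + K' = K. *)
Lemma max2_supplement K T : nmaximal_subalg 2 K -> lie_subalg T ->
  (T <= K)%VS -> (T + der K)%VS = K -> T = K.
Proof.
move=> mK sT TK TdK; apply/eqP/negPn/negP => nTK.
have [S TS mS] := maximal_containing sT (max2_subalg mK) TK nTK.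
have [_ _ SK nSK _] := mS.
have [_ idS] := ideal3 (nmaximal_subalgS mS mK).
have [dS _] : (der K <= S)%VS /\ hyperplane S K.
  by apply: maximal_ideal => //; split=> // x y _; apply: idS; exact: memvf.
by case/negP: nSK; rewrite eqEsubv SK -TdK subv_add TS.
Qed.

(** If [l, u] were outside U, some hyperplane of K above U would omit it; but that hyperplane is
    3-maximal, hence an ideal of L. *)
Lemma max2_intermediate K U : nmaximal_subalg 2 K -> (der K <= U)%VS ->
  (U <= K)%VS -> U != K -> forall l, {in U, forall u, bracket l u \in U}.
Proof.
move=> mK dU UK nUK l u Uu; apply/negPn/negP => Ulu.
have [H [UH hHK Hlu]] :
    exists H, [/\ (U <= H)%VS, hyperplane H K & bracket l u \notin H].
  have [Klu|Klu] := boolP (bracket l u \in K).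
    exact: hyperplane_avoiding.
  have [H UH hHK] := hyperplane_containing UK nUK.
  by exists H; split=> //; apply: contra Klu; exact/subvP/hHK.1.
have mH : maximal_subalg H K.
  apply: der_hyperplane_maximal hHK; first exact: max2_subalg.
  exact: subv_trans UH.
have [_ idH] := ideal3 (nmaximal_subalgS mH mK).
by case/negP: Hlu; rewrite idH ?memvf ?(subvP UH).
Qed.

Lemma max2_neq_addline K v : nmaximal_subalg 2 K -> (1 < \dim K)%N ->
  v \in K -> (der K + <[v]>)%VS != K.
Proof.
move=> mK dimK Kv; apply/eqP => KE.
have vK : <[v]>%VS = K.
  apply: max2_supplement => //; last by rewrite addvC.
  move=> _ _ /vlineP[a ->] /vlineP[b ->].
  by rewrite bracketZl bracketZr bracketxx !scaler0 mem0v.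
by move: dimK; rewrite -vK dim_vline; case: (v == 0).
Qed.

Lemma max2_bracket K l v : nmaximal_subalg 2 K -> (1 < \dim K)%N ->
  v \in K -> bracket l v \in (der K + <[v]>)%VS.
Proof.
move=> mK dimK Kv.
apply: (max2_intermediate mK (addvSl _ _) _ (max2_neq_addline mK dimK Kv) l).
  by rewrite subv_add -memvE Kv andbT; exact/lie_subalgE/max2_subalg.
by rewrite memvE addvSr.
Qed.

Lemma max2_ideal K l v : nmaximal_subalg 2 K -> (1 < \dim K)%N ->
  v \in K -> bracket l v \in K.
Proof.
move=> mK dimK Kv; have := max2_bracket l mK dimK Kv; apply/subvP.
by rewrite subv_add -memvE Kv andbT; exact/lie_subalgE/max2_subalg.
Qed.

(** K' has codimension at least two, since K' + <v> is never K. *)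
Lemma max2_dim K : nmaximal_subalg 2 K -> (1 < \dim K)%N ->
  ((\dim (der K)).+1 < \dim K)%N.
Proof.
move=> mK dimK; have sK := max2_subalg mK.
have [H dH hHK] : exists2 H, (der K <= H)%VS & hyperplane H K.
  by apply: der_containing => //; rewrite -dimv_eq0 -lt0n ltnW.
have [v Kv Hv] := hyperplane_outside hHK.
have dv : v \notin der K by apply: contra Hv; exact/subvP.
have dKv : (der K + <[v]> <= K)%VS.
  by rewrite subv_add -memvE Kv andbT; exact/lie_subalgE.
rewrite -(addline_hyperplane dv).2 ltn_neqAle dimvS // andbT.
apply: contra (max2_neq_addline mK dimK Kv) => dE.
by rewrite eqEdim dKv (eqP dE) /=.
Qed.

Hypothesis dimL : (3 < \dim (fullv : {vspace L}))%N.

(** Two steps of codimension one below dim L > 3 leave dim K > 1. *)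
Lemma max2_hyperplanes K M : (L' <= M)%VS -> hyperplane M fullv ->
  (der M <= K)%VS -> hyperplane K M -> nmaximal_subalg 2 K /\ (1 < \dim K)%N.
Proof.
move=> dM hM dK hK; split; last first.
  by move: dimL; rewrite hM.2 hK.2 !ltnS.
have sM := der_subalg dM hM.1.
apply: nmaximal_subalgS (der_hyperplane_maximal sM dK hK) _.
apply: nmaximal_subalg1; apply: der_hyperplane_maximal dM hM.
exact: lie_subalgf.
Qed.

(* If [y, v] were not in K' then some hyperplane H of K omits v, and H + <y>,
   being 2-maximal, is an ideal; so it contains [y, v], hence v. *)
Lemma der_hyperplane K M : (L' <= M)%VS -> hyperplane M fullv ->
  (der M <= K)%VS -> hyperplane K M -> der K = der M.
Proof.
move=> dM hM dK hK; have [mK dimK] := max2_hyperplanes dM hM dK hK.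
have sM := der_subalg dM hM.1; have sK := max2_subalg mK.
have [y My Ky] := hyperplane_outside hK.
have ME := hyperplane_addline hK My Ky.
apply: subv_anti; rewrite lie_prodS ?hK.1 //= {1 2}ME.
apply: addline_der_sub => // v Kv; apply/negPn/negP => dyv.
have Eyv := max2_bracket y mK dimK Kv.
have dv : v \notin der K.
  by apply: contra dyv => dv; apply: subvP Eyv; rewrite subv_add subvv -memvE.
have dKK : (der K <= K)%VS by exact/lie_subalgE.
have [H [dH hH Hv]] := hyperplane_avoiding dKK Kv dv.
case/negP: (Hv); apply: (memv_addline_swap Eyv dyv dH).
have yH : {in H, forall h, bracket y h \in H}.
  exact: (max2_intermediate mK dH hH.1 (hyperplane_neq hH) y).
(* H + <y> meets K in H, so it is enough to place [y, v] in both. *)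
apply: (memv_addlineI hH.1 Ky); last exact: max2_ideal.
have hT : hyperplane (H + <[y]>)%VS M by rewrite ME; exact: hyperplane_addline2.
have sT : lie_subalg (H + <[y]>)%VS.
  apply: addline_subalg; first exact: der_subalg dH hH.1.
  by move=> h /yH; exact/subvP/addvSl.
rewrite bracket_memC max2_ideal //.
- apply: nmaximal_subalgS (hyperplane_maximal sT sM hT) _.
  apply: nmaximal_subalg1; apply: der_hyperplane_maximal dM hM.
  exact: lie_subalgf.
- by rewrite (eq_add_S _ _ (etrans (esym hT.2) hK.2)).
- by rewrite memvE addvSr.
Qed.

(** Write L = M + <x> and suppose that [x, v] is not in M' for some v in M. A hyperplane K of M
    above M' + <v> has K' = M', so [x, v] lies in M' + <v>. A 2-maximal ideal I + <x> with M' <= I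
    <= M and v outside I contains [x, v], which then lies in I and brings v into I. *)
Lemma der_hyperplane_full M :
  (L' <= M)%VS -> hyperplane M fullv -> L' = der M.
Proof.
move=> dM hM; have sM := der_subalg dM hM.1.
have dMM : (der M <= M)%VS by exact/lie_subalgE.
(* K' = M' has codimension at least two in K, hence at least three in M. *)
have dim3 : ((\dim (der M)).+2 < \dim M)%N.
  have [K dK hK] : exists2 K, (der M <= K)%VS & hyperplane K M.
    apply: der_containing => //; rewrite -dimv_eq0 -lt0n.
    by move: dimL; rewrite hM.2 ltnS; exact: leq_trans.
  have [mK dimK] := max2_hyperplanes dM hM dK hK.
  by rewrite hK.2 ltnS -(der_hyperplane dM hM dK hK) max2_dim.
have [x _ Mx] := hyperplane_outside hM.
have LE := hyperplane_addline hM (memvf x) Mx.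
apply: subv_anti; rewrite andbC lie_prodS ?subvf //= {1 2}LE.
apply: addline_der_sub => // v Mv; apply/negPn/negP => dxv.
have Exv : bracket x v \in (der M + <[v]>)%VS.
  have [||K vK hK] := @hyperplane_containing _ _ (der M + <[v]>)%VS M.
  - by rewrite subv_add dMM -memvE.
  - apply: contraTneq dim3 => ME; rewrite -leqNgt -{1}ME.
    exact: leq_trans (dim_addline_leq _ _) _.
  have dK := subv_trans (addvSl _ _) vK.
  have [mK dimK] := max2_hyperplanes dM hM dK hK.
  rewrite -(der_hyperplane dM hM dK hK); apply: max2_bracket => //.
  by rewrite memvE (subv_trans (addvSr _ _) vK).
have dv : v \notin der M.
  by apply: contra dxv => dv; apply: subvP Exv; rewrite subv_add subvv -memvE.
have [H [dH hH Hv]] := hyperplane_avoiding dMM Mv dv.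
have [mH dimH] := max2_hyperplanes dM hM dH hH.
have dHE := der_hyperplane dM hM dH hH.
(* H + <x> is only 1-maximal; a second step down makes I + <x> 2-maximal. *)
have [I dI hI] : exists2 I, (der M <= I)%VS & hyperplane I H.
  apply: hyperplane_containing => //; apply: contraTneq dim3 => ->.
  by rewrite hH.2 -leqNgt.
case/negP: Hv; apply: (subvP hI.1); apply: (memv_addline_swap Exv dxv dI).
apply: (memv_addlineI (subv_trans hI.1 hH.1) Mx); last first.
  by apply: (subvP dM); rewrite memv_lie_prod ?memvf.
have hHx : hyperplane (H + <[x]>)%VS fullv by rewrite LE; exact: hyperplane_addline2.
have hIx : hyperplane (I + <[x]>)%VS (H + <[x]>)%VS.
  by apply: hyperplane_addline2 => //; apply: contra Mx; exact/subvP/hH.1.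
have sHx : lie_subalg (H + <[x]>)%VS.
  apply: addline_subalg; first exact: max2_subalg.
  by move=> h Hh; apply: (subvP (addvSl _ _)); exact: max2_ideal.
have sIx : lie_subalg (I + <[x]>)%VS.
  apply: addline_subalg => [|i Ii].
    by apply: der_subalg hI.1; rewrite dHE.
  apply: (subvP (addvSl _ _)).
  by apply: (max2_intermediate mH _ hI.1 (hyperplane_neq hI) x); rewrite ?dHE.
rewrite bracket_memC max2_ideal //.
- apply: nmaximal_subalgS (hyperplane_maximal sIx sHx hIx) _.
  apply: nmaximal_subalg1; apply: hyperplane_maximal => //.
  exact: lie_subalgf.
- by move: dimL; rewrite hHx.2 hIx.2 !ltnS.
- by rewrite memvE addvSr.
Qed.

Lemma ideal3_nilpotent : lie_nilpotent (fullv : {vspace L}).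
Proof.
have [M dM hM] : exists2 M, (L' <= M)%VS & hyperplane M fullv.
  apply: der_containing => //; first exact: lie_subalgf.
  by rewrite -dimv_eq0 -lt0n (leq_trans _ dimL).
have [K dK hK] : exists2 K, (der M <= K)%VS & hyperplane K M.
  apply: der_containing => //; first exact: der_subalg dM hM.1.
  by move: dimL; rewrite hM.2 ltnS -dimv_eq0 -lt0n; exact: leq_trans.
have [mK dimK] := max2_hyperplanes dM hM dK hK.
have dKE : der K = L'.
  by rewrite (der_hyperplane dM hM dK hK) (der_hyperplane_full dM hM).
have dKK : (L' <= K)%VS by rewrite -dKE; exact/lie_subalgE/max2_subalg.
apply: engel_solvable => //; apply: ad_nilpotent => T sT TL.
(* As K' = L' <= K, the modular law turns T + L' = L into (T meet K) + K' = K. Then T contains K,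
   hence L', and so is L. *)
suff TK : (T :&: K)%VS = K.
  by rewrite -TL; apply/esym/addv_idPl/(subv_trans dKK)/capv_idPr.
apply: max2_supplement => //; last 1 first.
- apply: subv_anti; rewrite dKE subv_add capvSr dKK /=.
  apply/subvP => k Kk.
  have /memv_addP[t Tt [l Ll kE]] : k \in (T + L')%VS by rewrite TL memvf.
  rewrite kE memv_add // memv_cap Tt /= -[t](addrK l) -kE memvB //.
  exact: (subvP dKK).
- move=> a b /memv_capP[Ta Ka] /memv_capP[Tb Kb].
  by rewrite memv_cap sT // (max2_subalg mK).
- exact: capvSr.
Qed.

(** M need not occur in the chain that makes K 2-maximal, but nilpotency fixes the codimension of K
    at two, so K is a hyperplane of M and [der_hyperplane] applies. *)
Lemma ideal3_frattini K M : nmaximal_subalg 2 K ->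
  maximal_subalg M fullv -> (K <= M)%VS -> frattini K = frattini M.
Proof.
have nilL := ideal3_nilpotent.
move=> mK mM KM; have [N mKN /nmaximal_subalg1P mN] := nmaximal_subalgSP mK.
have [_ hN] := nilpotent_maximal nilL mN.
have [_ hKN] := nilpotent_maximal nilL mKN.
have [dM hM] := nilpotent_maximal nilL mM.
have sM : lie_subalg M by case: mM.
have hK : hyperplane K M.
  by split=> //; apply: eq_add_S; rewrite -hM.2 hN.2 hKN.2.
have [dK _] := nilpotent_maximal nilL
  (hyperplane_maximal (max2_subalg mK) sM hK).
rewrite !frattini_nilpotent //; last exact: max2_subalg.
exact: der_hyperplane.
Qed.

End MaximalIdeals.

(** * From equal Frattini ideals back to 3-maximal ideals *)

(* S contains K' = M'. If M' has codimension 2 in M then S = M'. Otherwise the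
   equality of derived algebras makes L' a line over M', so any v in M lies in
   a hyperplane of M containing L', which forces L' = M'. *)
Lemma eq_frattini_ideal3 : lie_nilpotent (fullv : {vspace L}) ->
    (forall K M, nmaximal_subalg 2 K -> maximal_subalg M fullv ->
      (K <= M)%VS -> frattini K = frattini M) ->
  forall S, nmaximal_subalg 3 S -> lie_ideal S fullv.
Proof.
move=> nilL eqF S /nmaximal_subalgSP[K mS /nmaximal_subalgSP[M mK]].
move=> /nmaximal_subalg1P mM.
have [dS hS] := nilpotent_maximal nilL mS.
have [dK hK] := nilpotent_maximal nilL mK.
have [dM hM] := nilpotent_maximal nilL mM.
have sL : lie_subalg (fullv : {vspace L}) by exact: lie_subalgf.
have eq_der P Q : (L' <= Q)%VS -> hyperplane Q fullv ->
    (der Q <= P)%VS -> hyperplane P Q -> der P = der Q.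
  move=> dQ hQ dP hP; have sQ := der_subalg dQ hQ.1.
  have mQ := der_hyperplane_maximal sL dQ hQ.
  have mP := der_hyperplane_maximal sQ dP hP.
  rewrite -!frattini_nilpotent //; last by case: mP.
  by apply: eqF hP.1 => //; apply: nmaximal_subalgS mP (nmaximal_subalg1 mQ).
have MS : (der M <= S)%VS by rewrite -(eq_der K).
split=> [|l s _ Ss]; first exact: subvf.
have [dim2|dim2] := leqP (\dim M) (\dim (der M)).+2.
  have SE : der M = S.
    by apply/eqP; rewrite eqEdim MS -2!ltnS -hS.2 -hK.2.
  rewrite -SE in Ss *; apply: lie_prod_stable Ss => m _;
  by apply: (subvP dM); rewrite memv_lie_prod ?memvf.
have [x _ Mx] := hyperplane_outside hM.
have LE := hyperplane_addline hM (memvf x) Mx.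
(* P is a hyperplane of both M and Q = P + <x>, so Q' = P' = M', and [x, v] lies in Q'. *)
have x_hyper P : hyperplane P M -> (L' <= P)%VS ->
    {in P, forall v, bracket x v \in der M}.
  move=> hP dP v Pv; pose Q := (P + <[x]>)%VS.
  have hQ : hyperplane Q fullv by rewrite LE; exact: hyperplane_addline2.
  have hPQ : hyperplane P Q.
    by apply: addline_hyperplane; apply: contra Mx; exact/subvP/hP.1.
  have LdP U : (der U <= P)%VS by apply: subv_trans dP; rewrite lie_prodS ?subvf.
  have dQ : (L' <= Q)%VS := subv_trans dP (addvSl _ _).
  rewrite -(eq_der P) // (eq_der P Q) //.
  apply: memv_lie_prod; first by rewrite memvE addvSr.
  exact: (subvP (addvSl _ _)).
(* A maximal subalgebra through x contains L'; if L' were M, it would be M + <x> = L. *)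
have nL' : L' != M.
  apply/eqP => L'M; have [||||N xN mN] := @maximal_containing <[x]>%VS fullv.
  - move=> _ _ /vlineP[a ->] /vlineP[b ->].
    by rewrite bracketZl bracketZr bracketxx !scaler0 mem0v.
  - exact: sL.
  - exact: subvf.
  - apply/eqP => xL; have := leq_b1 (x != 0).
    by rewrite -dim_vline xL hM.2 ltnS leqNgt (leq_ltn_trans _ dim2).
  have [dN hN] := nilpotent_maximal nilL mN.
  have /negP[] := hyperplane_neq hN.
  by rewrite eqEsubv subvf /= LE subv_add xN -L'M dN.
have [P dP hP] := hyperplane_containing dM nL'.
have [w Mw Pw] := hyperplane_outside hP.
have ME := hyperplane_addline hP Mw Pw.
(* [x, P] <= M' and M = P + <w>, so only [x, w] can leave M'. *)
have L'line : (L' <= der M + <[bracket x w]>)%VS.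
  rewrite LE; apply: addline_der_sub; first exact: addvSl.
  move=> m; rewrite {1}ME => /memv_addlineP[p Pp [a ->]].
  rewrite bracketDr bracketZr memv_add ?(x_hyper P) //.
  by rewrite memvZ ?memv_line.
have L'dM : (L' <= der M)%VS.
  rewrite {1 2}LE; apply: addline_der_sub => // v Mv.
  (* L' + <v> has dimension at most dim M' + 2, which is less than dim M. *)
  have [||Q vQ hQ] := @hyperplane_containing _ _ (L' + <[v]>)%VS M.
  - by rewrite subv_add dM -memvE.
  - apply: contraTneq dim2 => QE; rewrite -leqNgt -{1}QE.
    apply: leq_trans (dim_addline_leq _ _) _; rewrite ltnS.
    exact: leq_trans (dimvS L'line) (dim_addline_leq _ _).
  apply: (x_hyper Q) => //; first exact: subv_trans (addvSl _ _) vQ.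
  by rewrite memvE (subv_trans (addvSr _ _) vQ).
by apply: (subvP MS); apply: (subvP L'dM); rewrite memv_lie_prod ?memvf.
Qed.

End Lie.

(** * The equivalence, including dimension at most three *)

Theorem theorem3p2 (F : fieldType) (L : lieAlgType F)
    (solL : lie_solvable (fullv : {vspace L})) :
  (forall S : {vspace L}, nmaximal_subalg 3 S -> lie_ideal S fullv)
  <->
  ((lie_nilpotent (fullv : {vspace L}) /\
    (forall K M : {vspace L},
       nmaximal_subalg 2 K -> maximal_subalg M fullv -> (K <= M)%VS ->
       frattini K = frattini M))
   \/ (\dim (fullv : {vspace L}) <= 3)%N).
Proof.
have [dimL|dimL] := leqP (\dim (fullv : {vspace L})) 3.
  (* Three strict inclusions inside dimension at most 3 force the bottom term to be 0, which is an
     ideal. *)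
  split=> [_|_ S [f [f0 f3 mf]]]; first by right.
  have f_lt i : (i < 3)%N -> (\dim (f i) < \dim (f i.+1))%N.
    move=> /mf[_ _ sf nf _]; rewrite ltn_neqAle dimvS // andbT.
    by apply: contra nf => /eqP df; rewrite eqEdim sf df /=.
  have : (\dim (f 0) + 3 <= \dim (f 3))%N.
    by rewrite addn3; do 3!apply: leq_ltn_trans (f_lt _ _) => //.
  rewrite f0 f3 => /leq_trans/(_ dimL); rewrite -{2}[3%N]add0n leq_add2r leqn0.
  rewrite dimv_eq0 => /eqP ->; split=> [|x y _]; first exact: sub0v.
  by rewrite memv0 => /eqP ->; rewrite bracket0r mem0v.
split=> [ideal3|[[nilL eqF]|//]].
  left; split; first exact: ideal3_nilpotent.
  by move=> K M; exact: ideal3_frattini.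
exact: eq_frattini_ideal3.
Qed.
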